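(* Let $A$ be an idempotent cancellative semiring. For an integer $n\ge1$ let $f_n:A\to A$, $f_n(a)=a^n$, and for any ideal $I$ of $A$ let $$I^{[n]}:=\Big\{x\in A\;\Big|\;x=\sum_{i=1}^s r_ia_i^n\text{ for some }a_i\in I,\ r_i\in A,\ s\in\mathbb N\Big\}.$$ Let $\mathcal I$ denote the collection of all ideals of $A$. Then $$I\mapsto I^{Frob}:=\bigcup_{n\ge1}f_n^{-1}\big(f_n(I)A\big)=\{x\in A\mid \exists\, n\ge1\text{ such that }x^n\in I^{[n]}\}$$ defines a closure operation on $\mathcal I$.
   Context: A semiring is a nonempty set $A$ with operations $+,\cdot$ such that $(A,+)$ and $(A,\cdot)$ are commutative monoids (with identities $0$ and $1$), $(a+b)c=ac+bc$ and $0\cdot a=0$; it is idempotent if $a+a=a$ for all $a$, and (multiplicatively) cancellative if $ac=bc$ with $c\ne0$ implies $a=b$. An ideal is an additive submonoid $I$ with $AI\subseteq I$; $f_n(I)A$ denotes the ideal generated by $f_n(I)$, i.e. $I^{[n]}$. The set $\mathcal I$ is partially ordered by inclusion. A closure operation on a poset $P$ is a map $\mathrm{cl}:P\to P$ with $x\le\mathrm{cl}(x)$, $\mathrm{cl}(\mathrm{cl}(x))=\mathrm{cl}(x)$, and $x\le y\Rightarrow\mathrm{cl}(x)\le\mathrm{cl}(y)$ for all $x,y\in P$. *)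

(* Defs.v *)
From HB Require Import structures.
From mathcomp Require Import all_boot all_order all_algebra.
From mathcomp Require Import boolp classical_sets.

Set Implicit Arguments.
Unset Strict Implicit.
Unset Printing Implicit Defensive.

Import Order.TTheory GRing.Theory.
Local Open Scope classical_set_scope.
Local Open Scope ring_scope.

(* Semirings are modelled by comPzSemiRingType rather than comNzSemiRingType,
   because 0 = 1 is not excluded. *)
Section Semiring.
Variable A : comPzSemiRingType.
Implicit Types (I : set A) (n : nat).

Definition idempotent_semiring : Prop := forall a : A, a + a = a.

Definition cancellative_semiring : Prop :=
  forall a b c : A, c != 0 -> a * c = b * c -> a = b.

Definition is_ideal I : Prop :=
  [/\ I 0,
      forall a b, I a -> I b -> I (a + b)
    & forall r a, I a -> I (r * a)].

Definition ideal_gen (X : set A) : set A := smallest is_ideal X.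

Definition power_map n : A -> A := fun a => a ^+ n.

Definition bracket_power I n : set A :=
  [set x | exists (s : nat) (r a : 'I_s -> A),
     (forall i, I (a i)) /\ x = \sum_(i < s) r i * a i ^+ n].

Definition frob I : set A :=
  \bigcup_(n in [set n | (1 <= n)%N])
     (power_map n @^-1` ideal_gen (power_map n @` I)).

End Semiring.

Record ideal (A : comPzSemiRingType) := Ideal {
  ideal_set :> set A;
  _ : `[< is_ideal ideal_set >] }.

HB.instance Definition _ (A : comPzSemiRingType) :=
  [isSub for @ideal_set A].
HB.instance Definition _ (A : comPzSemiRingType) :=
  [Choice of ideal A by <:].
HB.instance Definition _ (A : comPzSemiRingType) :=
  [SubChoice_isSubPOrder of ideal A by <: with set_display].

Lemma ideal_leE (A : comPzSemiRingType) (I J : ideal A) :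
  (I <= J)%O = (ideal_set I `<=` ideal_set J) :> Prop.
Proof. by rewrite -subsetEset. Qed.

Definition closure_operation (d : Order.disp_t) (P : porderType d)
    (cl : P -> P) : Prop :=
  [/\ forall x, (x <= cl x)%O,
      forall x, cl (cl x) = cl x
    & forall x y, (x <= y)%O -> (cl x <= cl y)%O].

(* Main.v *)
Require Import Defs.
From mathcomp Require Import all_boot all_order all_algebra.
From mathcomp Require Import boolp classical_sets.
From mathcomp Require Import ring zify.

(** In an idempotent cancellative semiring every power map [f_n] is additive:
    the expansions of [(a^n + b^n)(a + b)^(n-1)] and [(a + b)^(2n-1)] contain
    the same monomials, since a monomial of degree [2n-1] in [a] and [b] is
    divisible by [a^n] or by [b^n], and [(a + b)^(n-1)] can be cancelled.
    Hence [x \in I^[n]] implies [x^m \in I^[nm]], so that exponents witnessing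
    membership in [I^Frob] can be replaced by common multiples. *)

Import GRing.Theory.
Local Open Scope classical_set_scope.
Local Open Scope ring_scope.

(** * Natural order of an idempotent semiring; additivity of powers *)

Section PowerAdditive.
Variable A : comPzSemiRingType.
Hypothesis idem : idempotent_semiring A.
Implicit Types (x y z a b : A) (n : nat).

(** The natural order of an idempotent semiring, for which [x + y] is the join of [x] and [y]. *)
Definition idem_le x y := x + y = y.

Lemma idem_le_refl x : idem_le x x.
Proof. exact: idem. Qed.

Lemma idem_le_trans y x z : idem_le x y -> idem_le y z -> idem_le x z.
Proof. by rewrite /idem_le => xy yz; rewrite -yz addrA xy. Qed.

Lemma idem_le_anti x y : idem_le x y -> idem_le y x -> x = y.
Proof. by rewrite /idem_le => xy yx; rewrite -yx addrC xy. Qed.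

Lemma idem_le_addr x y : idem_le x (x + y).
Proof. by rewrite /idem_le addrA idem. Qed.

Lemma idem_le_addl x y : idem_le x (y + x).
Proof. by rewrite addrC; exact: idem_le_addr. Qed.

Lemma idem_le_add_lub x y z : idem_le x z -> idem_le y z -> idem_le (x + y) z.
Proof. by rewrite /idem_le => xz yz; rewrite -addrA yz. Qed.

Lemma idem_le_mul x x' y y' :
  idem_le x x' -> idem_le y y' -> idem_le (x * y) (x' * y').
Proof.
move=> xx' yy'; apply: (@idem_le_trans (x' * y)).
  by rewrite /idem_le -mulrDl xx'.
by rewrite /idem_le -mulrDr yy'.
Qed.

Lemma idem_le_exp x y n : idem_le x y -> idem_le (x ^+ n) (y ^+ n).
Proof.
move=> xy; elim: n => [|n IHn]; first by rewrite !expr0; exact: idem_le_refl.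
by rewrite !exprS; exact: idem_le_mul.
Qed.

Lemma monomial_le_exp a b i j : idem_le (a ^+ i * b ^+ j) ((a + b) ^+ (i + j)).
Proof.
rewrite exprD; apply: idem_le_mul; apply: idem_le_exp.
  exact: idem_le_addr.
exact: idem_le_addl.
Qed.

(** Pigeonhole: either [n < i] or [n < j]. Splitting off that [n.+1]-st power leaves a monomial of
    degree [n], which lies below [(a + b) ^+ n]. *)
Lemma monomial_le a b n i j : (i + j = n.+1 + n)%N ->
  idem_le (a ^+ i * b ^+ j) ((a ^+ n.+1 + b ^+ n.+1) * (a + b) ^+ n).
Proof.
move=> ij; have [lt_ni|le_in] := ltnP n i.
  rewrite -(subnKC lt_ni) exprD -mulrA.
  apply: idem_le_mul; first exact: idem_le_addr.
  have -> : ((a + b) ^+ n = (a + b) ^+ (i - n.+1 + j))%R by congr (_ ^+ _); lia.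
  exact: monomial_le_exp.
have lt_nj : (n < j)%N by lia.
rewrite -(subnKC lt_nj) exprD mulrCA.
apply: idem_le_mul; first exact: idem_le_addl.
have -> : ((a + b) ^+ n = (a + b) ^+ (i + (j - n.+1)))%R by congr (_ ^+ _); lia.
exact: monomial_le_exp.
Qed.

(** Replaces the binomial theorem: a sum lies below [z] once its terms do, so coefficients never
    matter. The prefix [a ^+ i * b ^+ j] collects the factors already chosen in the induction on
    [p]. *)
Lemma expand_le a b z p i j :
    (forall k l, (k + l = i + j + p)%N -> idem_le (a ^+ k * b ^+ l) z) ->
  idem_le (a ^+ i * b ^+ j * (a + b) ^+ p) z.
Proof.
elim: p i j => [|p IHp] i j le_z; first by rewrite mulr1; apply: le_z; lia.
have -> : a ^+ i * b ^+ j * (a + b) ^+ p.+1 =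
    a ^+ i.+1 * b ^+ j * (a + b) ^+ p + a ^+ i * b ^+ j.+1 * (a + b) ^+ p.
  by rewrite !exprS; ring.
by apply: idem_le_add_lub; apply: IHp => k l kl; apply: le_z; lia.
Qed.

Lemma exp_add_mul a b n :
  (a + b) ^+ n.+1 * (a + b) ^+ n = (a ^+ n.+1 + b ^+ n.+1) * (a + b) ^+ n.
Proof.
apply: idem_le_anti.
  (* The inserted [1 * 1] is the empty prefix [a ^+ 0 * b ^+ 0]. *)
  rewrite -exprD -[X in idem_le X]mul1r -[1]mulr1.
  have := @expand_le a b ((a ^+ n.+1 + b ^+ n.+1) * (a + b) ^+ n)
                     (n.+1 + n) 0 0.
  by rewrite !expr0; apply=> k l; exact: monomial_le.
apply: idem_le_mul (idem_le_refl _).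
apply: idem_le_add_lub; apply: idem_le_exp.
  exact: idem_le_addr.
exact: idem_le_addl.
Qed.

Hypothesis canc : cancellative_semiring A.

Lemma expr_eq0_cancellative x n : x ^+ n = 0 -> x = 0.
Proof.
elim: n => [|n IHn]; first by rewrite expr0 => one0; rewrite -[x]mulr1 one0 mulr0.
have [/IHn //|xn0] := eqVneq (x ^+ n) 0.
by rewrite exprS => xx0; apply: (canc _ _ _ xn0); rewrite mul0r.
Qed.

Lemma expr_add a b n : (0 < n)%N -> (a + b) ^+ n = a ^+ n + b ^+ n.
Proof.
case: n => // n _; have [/expr_eq0_cancellative ab0|abn0] :=
  eqVneq ((a + b) ^+ n) 0; last exact: canc abn0 (exp_add_mul a b n).
(* The factor to cancel may vanish only if [a + b = 0]; then [a = a + (a + b) = a + b = 0] by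
   idempotence. *)
have a0 : a = 0 by rewrite -[LHS]addr0 -ab0 addrA idem.
have b0 : b = 0 by rewrite -ab0 a0 add0r.
by rewrite a0 b0 add0r exprS mul0r add0r.
Qed.

End PowerAdditive.

(** * Bracket powers and the Frobenius closure *)

Section FrobeniusClosure.
Variable A : comPzSemiRingType.
Implicit Types (I J : set A) (x y r : A) (n m : nat).

Lemma is_ideal_gen (X : set A) : is_ideal (ideal_gen X).
Proof.
split=> [J [[] //]|x y Xx Xy J XJ|r x Xx J XJ].
  by case: (XJ) => -[_ Jadd _] _; apply: Jadd; [exact: Xx|exact: Xy].
by case: (XJ) => -[_ _ Jmul] _; apply: Jmul; exact: Xx.
Qed.

Lemma is_ideal_bracket_power I n : is_ideal (bracket_power I n).
Proof.
split.
- by exists 0, (fun=> 0), (fun=> 0); split=> [[]//|]; rewrite big_ord0.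
- move=> _ _ [s [r [a [Ia ->]]]] [t [q [b [Ib ->]]]].
  pose glue (f : 'I_s -> A) (g : 'I_t -> A) (i : 'I_(s + t)) :=
    match split i with inl j => f j | inr k => g k end.
  exists (s + t)%N, (glue r q), (glue a b); split.
    by rewrite /glue => i; case: (split i).
  rewrite big_split_ord /=; congr (_ + _); apply: eq_bigr => i _; rewrite /glue.
    by rewrite (unsplitK (inl i)).
  by rewrite (unsplitK (inr i)).
- move=> p _ [s [r [a [Ia ->]]]].
  exists s, (fun i => p * r i), a; split=> //.
  by rewrite mulr_sumr; apply: eq_bigr => i _; rewrite mulrA.
Qed.

Lemma ideal_gen_power_map I n :
  ideal_gen (power_map n @` I) = bracket_power I n.
Proof.
apply/seteqP; split.
  apply: smallest_sub; first exact: is_ideal_bracket_power.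
  move=> _ [x Ix <-]; exists 1, (fun=> 1), (fun=> x); split=> //.
  by rewrite big_ord1 mul1r.
move=> _ [s [r [a [Ia ->]]]]; have [G0 Gadd Gmul] := is_ideal_gen (power_map n @` I).
apply: big_ind => // i _; apply: Gmul; apply: sub_gen_smallest.
by exists (a i).
Qed.

Lemma frobE I :
  frob I = [set x | exists n, (1 <= n)%N /\ bracket_power I n (x ^+ n)].
Proof.
apply/seteqP; split=> x.
  by move=> [n n1]; rewrite ideal_gen_power_map => xn; exists n.
by move=> [n [n1 xn]]; exists n; rewrite // ideal_gen_power_map.
Qed.

Lemma bracket_power_base {I n x} : I x -> bracket_power I n (x ^+ n).
Proof.
by move=> Ix; rewrite -ideal_gen_power_map; apply: sub_gen_smallest; exists x.
Qed.

(** Serves as an induction principle: membership in an ideal is checked on [n]-th powers only,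
    without handling sums. *)
Lemma bracket_power_min {I J n} : is_ideal J -> (forall x, I x -> J (x ^+ n)) ->
  bracket_power I n `<=` J.
Proof.
move=> idJ IJ; rewrite -ideal_gen_power_map; apply: smallest_sub => //.
by move=> _ [x Ix <-]; exact: IJ.
Qed.

Lemma bracket_powerS I J n : I `<=` J -> bracket_power I n `<=` bracket_power J n.
Proof.
move=> IJ; apply: bracket_power_min (is_ideal_bracket_power J n) _ => x /IJ.
exact: bracket_power_base.
Qed.

Lemma sub_frob I : I `<=` frob I.
Proof.
by rewrite frobE => x Ix; exists 1%N; split=> //; exact: bracket_power_base.
Qed.

Lemma frobS I J : I `<=` J -> frob I `<=` frob J.
Proof.
move=> IJ; rewrite !frobE => x [n [n1 xn]]; exists n; split=> //.
exact: bracket_powerS xn.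
Qed.

Hypothesis idem : idempotent_semiring A.
Hypothesis canc : cancellative_semiring A.

(** As the [m]-th power map is additive and multiplicative, the preimage of an ideal under it is an
    ideal; this one contains [a ^+ n] for [a] in [I]. *)
Lemma bracket_power_exp {I n m x} : (0 < m)%N ->
  bracket_power I n x -> bracket_power I (n * m)%N (x ^+ m).
Proof.
move=> m0; have [B0 Badd Bmul] := is_ideal_bracket_power I (n * m)%N.
move: x; apply: (bracket_power_min
  (J := [set x | bracket_power I (n * m)%N (x ^+ m)])).
  split=> [|x y xm ym|r x xm] /=.
  - by rewrite expr0n; case: m m0 {Badd Bmul} B0.
  - by rewrite expr_add //; exact: Badd.
  - by rewrite exprMn; exact: Bmul.
by move=> x Ix; rewrite /= -exprM; exact: bracket_power_base.
Qed.

(* [I^Frob] is the case [n = 1]; general [n] yields the idempotence of Frob,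
   because this ideal contains [x^n] for every [x] in [I^Frob]. *)
Lemma is_ideal_frob_twist I n :
  is_ideal [set x | exists m, (1 <= m)%N /\ bracket_power I (n * m)%N (x ^+ m)].
Proof.
split=> [|x y [m [m1 xm]] [k [k1 yk]]|r x [m [m1 xm]]].
- exists 1%N; split=> //; rewrite expr1.
  by case: (is_ideal_bracket_power I (n * 1)%N).
(* A common exponent: raise [x ^+ m] to the power [k] and [y ^+ k] to the power [m]. *)
- exists (m * k)%N; split; first by rewrite muln_gt0 m1.
  have [_ Badd _] := is_ideal_bracket_power I (n * (m * k))%N.
  rewrite expr_add ?muln_gt0 ?m1 //; apply: Badd.
    by rewrite exprM mulnA; exact: bracket_power_exp.
  by rewrite (mulnC m) exprM mulnA; exact: bracket_power_exp.
- exists m; split=> //; rewrite exprMn.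
  by have [_ _ Bmul] := is_ideal_bracket_power I (n * m)%N; exact: Bmul.
Qed.

Lemma is_ideal_frob I : is_ideal (frob I).
Proof.
rewrite frobE; have := is_ideal_frob_twist I 1.
by under [X in is_ideal X]eq_set => x do under eq_exists => m do rewrite mul1n.
Qed.

Lemma frob_frob I : frob (frob I) = frob I.
Proof.
apply/seteqP; split; last exact: sub_frob.
rewrite {1}frobE => x [n [n1 xn]].
(* The twisted ideal contains [y ^+ n] for each [y] in [frob I], hence also [x ^+ n]; the resulting
   [m] makes [n * m] an exponent for [x] over [I]. *)
have [] := bracket_power_min (is_ideal_frob_twist I n) _ _ xn.
  move=> y; rewrite frobE => -[m [m1 ym]]; exists m; split=> //.
  by rewrite -exprM mulnC exprM; exact: bracket_power_exp.
move=> m [m1]; rewrite -exprM => xnm; rewrite frobE; exists (n * m)%N.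
by rewrite muln_gt0 n1.
Qed.

End FrobeniusClosure.

Theorem proposition5p9 (A : comPzSemiRingType)
    (hidem : idempotent_semiring A) (hcanc : cancellative_semiring A) :
  (forall I : ideal A,
     frob I = [set x : A | exists n : nat,
                 (1 <= n)%N /\ bracket_power I n (x ^+ n)]) /\
  (exists cl : ideal A -> ideal A,
     (forall I : ideal A, ideal_set (cl I) = frob I) /\
     closure_operation cl).
Proof.
split=> [I|]; first exact: frobE.
exists (fun I : ideal A => Ideal (asboolT (is_ideal_frob _ hidem hcanc I))).
split=> //.
split=> [I|I|I J].
- by rewrite ideal_leE; exact: sub_frob.
- by apply: val_inj; exact: frob_frob.
- by rewrite !ideal_leE; exact: frobS.
Qed.
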